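(* Let $n\ge 2$, let $p^1\in\mathbb{R}^2$ be a fixed point and let $\mathbb{P}=\{p^2,p^3,\dots,p^n\}\subset\mathbb{R}^2$ be a set of points such that $p^1,p^2,\dots,p^n$ are distinct. Let $$\mathcal{N}_D(p^1)=\operatorname*{argmin}_{p^j\in\{p^2,\dots,p^n\}}\left(\frac{d_{p^1p^j}}{2}+\frac{x_{p^j}-x_{p^1}}{2}\right)$$ (the set of all minimizers), and let $\mathcal{N}_V(p^1)$ be the set of Voronoi neighbors of $p^1$. Then $\mathcal{N}_D(p^1)\subseteq\mathcal{N}_V(p^1)$.
   Context: For points $p=(x_p,y_p)$ and $q=(x_q,y_q)$ in $\mathbb{R}^2$, $d_{pq}$ is the Euclidean distance. Fix a constant $B>0$. The energy metric is $J(p,q)=2B(d_{pq}+x_p-x_q)$ (the minimum energy needed to travel from $p$ to $q$ in the constant flow $(B,0)$). The energy-based Voronoi cell of $p^i$ with respect to the generators $p^1,\dots,p^n$ is $V(p^i)=\{p\in\mathbb{R}^2 : J(p^i,p)\le J(p^j,p)\text{ for all } j\ne i,\ j\in\{1,\dots,n\}\}$. A point $p\in\mathbb{P}$ is a Voronoi neighbor of $p^1$ if $V(p^1)\cap V(p)$ is non-empty and is not a single point; $\mathcal{N}_V(p^1)$ is the set of all Voronoi neighbors of $p^1$. *)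

(* Defs.v *)
From HB Require Import structures.
From mathcomp Require Import all_boot all_order all_algebra.
From mathcomp Require Import boolp classical_sets reals.

Set Implicit Arguments.
Unset Strict Implicit.
Unset Printing Implicit Defensive.

Import Order.TTheory GRing.Theory Num.Theory.
Local Open Scope classical_set_scope.
Local Open Scope ring_scope.

(* Points of the plane are pairs [(x, y) : R * R].  The norm that the library
   puts on [R * R] is the max norm, so the Euclidean distance is spelled out. *)
Definition edist (R : realType) (p q : R * R) : R :=
  Num.sqrt ((p.1 - q.1) ^+ 2 + (p.2 - q.2) ^+ 2).

(* Minimum energy needed to travel from [p] to [q] in the constant flow
   [(B, 0)]. *)
Definition energy (R : realType) (B : R) (p q : R * R) : R :=
  2 * B * (edist p q + p.1 - q.1).

Definition voronoi_cell (R : realType) (B : R) (n : nat) (p : 'I_n -> R * R)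
    (i : 'I_n) : set (R * R) :=
  [set q | forall j : 'I_n, j != i -> energy B (p i) q <= energy B (p j) q].

Definition argmin (R : realType) (T : Type) (A : set T) (f : T -> R) : set T :=
  [set a | A a /\ forall b, A b -> f a <= f b].

(* Generators are numbered from 0: the distinguished generator, numbered 1 in
   the mathematical notation, has index 0 here. *)
Definition first_index (n : nat) (hn : (2 <= n)%N) : 'I_n :=
  Ordinal (ltnW hn).

Definition other_points (R : realType) (n : nat) (p : 'I_n -> R * R)
    (i : 'I_n) : set (R * R) :=
  [set p j | j in [set j : 'I_n | j != i]].

Definition N_D (R : realType) (n : nat) (p : 'I_n -> R * R) (i : 'I_n) :
    set (R * R) :=
  argmin (other_points p i)
    (fun q => edist (p i) q / 2 + (q.1 - (p i).1) / 2).

Definition N_V (R : realType) (B : R) (n : nat) (p : 'I_n -> R * R)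
    (i : 'I_n) : set (R * R) :=
  [set p j | j in [set j : 'I_n | [/\ j != i,
     voronoi_cell B p i `&` voronoi_cell B p j !=set0 &
     ~ exists q, voronoi_cell B p i `&` voronoi_cell B p j = [set q]]]].

(* Main.v *)
Require Import Defs.
From HB Require Import structures.
From mathcomp Require Import all_boot all_order all_algebra.
From mathcomp Require Import boolp classical_sets reals.
From mathcomp Require Import ring lra.

Set Implicit Arguments.
Unset Strict Implicit.
Unset Printing Implicit Defensive.

Import Order.TTheory GRing.Theory Num.Theory.
Local Open Scope classical_set_scope.
Local Open Scope ring_scope.

(** Put [p^1] at the origin and let [(x, y)] be a minimizer, at distance [d].
If [y = 0], every point [(t, 0)] with [t >= |x|] lies in both cells.
If [y != 0], the bisector of the origin and [(x, y)] is a hyperbola branch,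
parametrized rationally by [s = |q| - q.1 > 0].  In this parameter, the
condition that the origin beats another generator at [q] is implied by an
affine inequality in [s].  At [s = y^2 / (2 d)], that is, at the point of the
segment from the origin to [(x, y)] at distance [(d + x) / 2] from the origin,
minimality makes all these affine inequalities strict, so that finitely many of
them persist for a slightly larger [s], which gives a second common point. *)

Lemma edist_eq (R : realType) (p q : R * R) (r : R) :
  0 <= r -> r ^+ 2 = (p.1 - q.1) ^+ 2 + (p.2 - q.2) ^+ 2 -> edist p q = r.
Proof. by move=> r0 rE; rewrite /edist -rE sqrtr_sqr ger0_norm. Qed.

Lemma edist_sqr (R : realType) (p q : R * R) :
  edist p q ^+ 2 = (p.1 - q.1) ^+ 2 + (p.2 - q.2) ^+ 2.
Proof. by rewrite /edist sqr_sqrtr // addr_ge0 // sqr_ge0. Qed.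

Lemma le_edist (R : realType) (p q : R * R) (c : R) :
  c ^+ 2 <= (p.1 - q.1) ^+ 2 + (p.2 - q.2) ^+ 2 -> c <= edist p q.
Proof.
move=> cle; rewrite (le_trans (ler_norm c)) // -sqrtr_sqr.
exact: ler_wsqrtr.
Qed.

Lemma shared_cell (R : realType) (B : R) (n : nat) (p : 'I_n -> R * R)
    (i j : 'I_n) (q : R * R) :
  0 < B ->
  (forall k, edist (p i) q + (p i).1 <= edist (p k) q + (p k).1) ->
  edist (p i) q + (p i).1 = edist (p j) q + (p j).1 ->
  (voronoi_cell B p i `&` voronoi_cell B p j) q.
Proof.
move=> B0 ile ij; split=> k _; rewrite /energy ler_pM2l ?mulr_gt0 //.
  by rewrite lerD2r.
by rewrite lerD2r -ij.
Qed.

(* Squaring [r - x_k <= d(p_k, q)] cancels the quadratic terms in [q]. *)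
Lemma shared_cell_affine (R : realType) (B : R) (n : nat) (p : 'I_n -> R * R)
    (i j : 'I_n) (u v r : R) :
  0 < B -> 0 <= r -> r ^+ 2 = u ^+ 2 + v ^+ 2 ->
  (forall k, 0 <= ((p k).2 - (p i).2) ^+ 2 - 2 * v * ((p k).2 - (p i).2)
                 + 2 * (r - u) * ((p k).1 - (p i).1)) ->
  ((p j).2 - (p i).2) ^+ 2 - 2 * v * ((p j).2 - (p i).2)
    + 2 * (r - u) * ((p j).1 - (p i).1) = 0 ->
  (p j).1 - (p i).1 <= r ->
  (voronoi_cell B p i `&` voronoi_cell B p j) ((p i).1 + u, (p i).2 + v).
Proof.
move=> B0 r0 rE kge jE jr.
have iE : edist (p i) ((p i).1 + u, (p i).2 + v) = r.
  by apply: edist_eq => //=; rewrite rE; ring.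
apply: shared_cell => // [k|]; rewrite iE.
  rewrite -lerBlDr; apply: le_edist => /=.
  by move: (kge k) rE; nra.
(* For [j] the squaring must be reversible: the last hypothesis makes this candidate distance
   nonnegative, which rules out the other branch of the hyperbola. *)
rewrite (@edist_eq _ (p j) _ (r + (p i).1 - (p j).1)) /=.
- by ring.
- lra.
- by move: jE rE; nra.
Qed.

(** Multiplied by [d], the expression is a sum of two terms: one is nonnegative because
    [d + x <= dk + xk], the other by Cauchy-Schwarz. If both vanished, the vectors would be parallel
    and then equal, against the last hypothesis. *)
Lemma affine_gt0 (R : realFieldType) (x y d xk yk dk : R) :
  y != 0 -> 0 <= d -> d ^+ 2 = x ^+ 2 + y ^+ 2 ->
  0 <= dk -> dk ^+ 2 = xk ^+ 2 + yk ^+ 2 ->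
  d + x <= dk + xk -> (xk, yk) != (x, y) ->
  0 < yk ^+ 2 - y * yk + 2 * (y ^+ 2 / (2 * d)) * (xk - x * yk / y).
Proof.
move=> y0 d0 dE dk0 dkE le_dx neq.
have yy : 0 < y ^+ 2 by rewrite exprn_even_gt0.
have dgt : 0 < d by rewrite lt_neqAle d0 andbT eq_sym; apply/eqP => d00; nra.
have m0 : 0 < d + x by nra.
have dkx : 0 <= dk - xk by nra.
have cs : 0 <= d * dk - (x * xk + y * yk).
  have : `|x * xk + y * yk| <= `|d * dk|.
    rewrite -ler_sqr ?nnegrE ?normr_ge0 // !real_normK ?num_real //.
    have := sqr_ge0 (x * yk - y * xk); rewrite exprMn dE dkE; nra.
  rewrite (ger0_norm (mulr_ge0 d0 dk0)) subr_ge0.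
  exact: le_trans (ler_norm _).
have -> : yk ^+ 2 - y * yk + 2 * (y ^+ 2 / (2 * d)) * (xk - x * yk / y) =
  ((dk - xk) * (dk + xk - (d + x)) * d
   + (d + x) * (d * dk - (x * xk + y * yk))) / d.
  have ykE : yk ^+ 2 = dk ^+ 2 - xk ^+ 2 by rewrite dkE; ring.
  have yE : y ^+ 2 = d ^+ 2 - x ^+ 2 by rewrite dE; ring.
  have -> : 2 * (y ^+ 2 / (2 * d)) * (xk - x * yk / y) =
     (y ^+ 2 * xk - x * y * yk) / d by field; rewrite y0 gt_eqF.
  by rewrite yE ykE; field; rewrite gt_eqF.
rewrite divr_gt0 //.
have h1 : 0 <= (dk - xk) * (dk + xk - (d + x)) * d.
  by rewrite !mulr_ge0 // subr_ge0.
have h2 : 0 <= (d + x) * (d * dk - (x * xk + y * yk)).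
  by rewrite mulr_ge0 // ltW.
rewrite lt_neqAle addr_ge0 // andbT eq_sym paddr_eq0 //.
apply: contra neq; rewrite !mulf_eq0 (gt_eqF m0) (gt_eqF dgt) orbF /=.
move=> /andP[h /eqP csE].
have col : x * yk - y * xk = 0.
  apply/eqP; rewrite -sqrf_eq0.
  have -> : (x * yk - y * xk) ^+ 2
      = d ^+ 2 * dk ^+ 2 - (x * xk + y * yk) ^+ 2 by rewrite dE dkE; ring.
  by rewrite -exprMn subr_sqr csE mul0r.
have dxk : d * xk = dk * x.
  apply: (mulfI (lt0r_neq0 dgt)).
  have -> : d * (d * xk) = d ^+ 2 * xk by ring.
  have -> : d * (dk * x) = (d * dk) * x by ring.
  have -> : d * dk = x * xk + y * yk by lra.
  by rewrite dE; apply/eqP; rewrite -subr_eq0; apply/eqP;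
     rewrite -[RHS](mulr0 (- y)) -col; ring.
have dyk : d * yk = dk * y.
  apply: (mulfI (lt0r_neq0 dgt)).
  have -> : d * (d * yk) = d ^+ 2 * yk by ring.
  have -> : d * (dk * y) = (d * dk) * y by ring.
  have -> : d * dk = x * xk + y * yk by lra.
  by rewrite dE; apply/eqP; rewrite -subr_eq0; apply/eqP;
     rewrite -[RHS](mulr0 x) -col; ring.
have dkd : dk = d.
  (* If [dk = xk], proportionality forces [dk = 0], against [0 < d + x <= dk + xk], or [d = x],
     against [y != 0]. If [dk + xk = d + x], it forces equal lengths. *)
  case/orP: h => /eqP h.
    have xkE : xk = dk by lra.
    have : dk * (d - x) = 0 by rewrite mulrBr -dxk xkE; ring.
    move/eqP; rewrite mulf_eq0 => /orP[/eqP dk00|/eqP dx]; exfalso; nra.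
  have : (dk - d) * (d + x) = 0.
    have -> : (dk - d) * (d + x) = dk * d + dk * x - d * (d + x) by ring.
    by rewrite -dxk -[RHS](mulr0 d) -h; ring.
  by move/eqP; rewrite mulf_eq0 (gt_eqF m0) orbF subr_eq0 => /eqP.
have d_neq0 := lt0r_neq0 dgt.
by rewrite xpair_eqE -(inj_eq (mulfI d_neq0)) dxk dkd eqxx /=
  -(inj_eq (mulfI d_neq0)) dyk dkd.
Qed.

Lemma exists_small_step (R : realFieldType) (I : finType) (P : pred I)
    (a b : I -> R) :
  (forall k, P k -> 0 < a k) ->
  exists2 e, 0 < e & forall k, P k -> 0 <= a k + e * b k.
Proof.
(* [S] bounds every ratio [|b k| / a k], so the step [1 / S] suits all [k] at once; the summand 1
   keeps [S] positive when the sum is zero. *)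
move=> a0; pose S := 1 + \sum_(k | P k) `|b k| / a k.
have term_ge0 k : P k -> 0 <= `|b k| / a k.
  by move=> Pk; rewrite divr_ge0 // ltW // a0.
have S0 : 0 < S by rewrite ltr_wpDr // sumr_ge0.
exists S^-1 => [|k Pk]; first by rewrite invr_gt0.
have bS : `|b k| <= S * a k.
  rewrite -ler_pdivrMr ?a0 // /S (bigD1 k) //=.
  have : 0 <= \sum_(l | P l && (l != k)) `|b l| / a l.
    by apply: sumr_ge0 => l /andP[Pl _]; exact: term_ge0.
  lra.
have -> : a k + S^-1 * b k = (S * a k + b k) / S by field; rewrite gt_eqF.
rewrite divr_ge0 ?(ltW S0) //.
by have := ler_norm (- b k); rewrite normrN; lra.
Qed.

(** Two distinct common points show at once that the intersection is non-empty and not a single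
    point. *)
Lemma two_shared_points (R : realType) (B : R) (n : nat) (p : 'I_n -> R * R)
    (i j : 'I_n) :
  0 < B -> injective p ->
  (forall k, k != i -> edist (p i) (p j) + (p j).1 <=
                       edist (p i) (p k) + (p k).1) ->
  exists q1 q2, [/\ q1 != q2,
    (voronoi_cell B p i `&` voronoi_cell B p j) q1 &
    (voronoi_cell B p i `&` voronoi_cell B p j) q2].
Proof.
move=> B0 pinj jmin.
set x := (p j).1 - (p i).1; set y := (p j).2 - (p i).2.
have [y0|y0] := eqVneq y 0.
  have ray t : `|x| <= t ->
      (voronoi_cell B p i `&` voronoi_cell B p j) ((p i).1 + t, (p i).2 + 0).
    move=> xt; apply: (@shared_cell_affine _ _ _ _ _ _ t 0 t) => //.
    - exact: le_trans xt.
    - by ring.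
    - move=> k; rewrite subrr !mulr0 !mul0r subr0 addr0; exact: sqr_ge0.
    - by rewrite -/y y0; ring.
    - exact: le_trans (ler_norm _) xt.
  exists ((p i).1 + `|x|, (p i).2 + 0), ((p i).1 + (`|x| + 1), (p i).2 + 0).
  split; [|exact: ray|by apply: ray; lra].
  rewrite xpair_eqE eqxx andbT; apply/eqP; lra.
(* With [s = r - u], the tie with [p j] is linear in [v] and [s] and gives [v]; then
   [r ^+ 2 - u ^+ 2 = v ^+ 2] gives [r + u = v ^+ 2 / s], hence [u] and [r]. *)
pose v s := y / 2 + x * s / y.
pose u s := (v s ^+ 2 / s - s) / 2.
pose r s := (v s ^+ 2 / s + s) / 2.
pose L k s := ((p k).2 - (p i).2) ^+ 2 - y * ((p k).2 - (p i).2)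
   + 2 * s * (((p k).1 - (p i).1) - x * ((p k).2 - (p i).2) / y).
have LE k s : s != 0 -> ((p k).2 - (p i).2) ^+ 2 - 2 * v s * ((p k).2 - (p i).2)
    + 2 * (r s - u s) * ((p k).1 - (p i).1) = L k s.
  by move=> s0; rewrite /L /r /u /v; field; rewrite y0.
have Lj s : L j s = 0.
  by rewrite /L -/x -/y; field; rewrite y0.
have Li s : L i s = 0.
  by rewrite /L !subrr; ring.
have shared s : 0 < s -> (forall k, k != i -> k != j -> 0 <= L k s) ->
    (voronoi_cell B p i `&` voronoi_cell B p j) ((p i).1 + u s, (p i).2 + v s).
  move=> s0 Lge.
  apply: (@shared_cell_affine _ _ _ _ _ _ (u s) (v s) (r s)) => //.
  - by rewrite /r divr_ge0 // addr_ge0 ?divr_ge0 ?sqr_ge0 // ltW.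
  - by rewrite /r /u; field; rewrite gt_eqF.
  - move=> k; rewrite LE ?gt_eqF //.
    have [->|ki] := eqVneq k i; first by rewrite Li.
    have [->|kj] := eqVneq k j; first by rewrite Lj.
    exact: Lge.
  - by rewrite LE ?gt_eqF.
  - rewrite -/x -subr_ge0.
    (* Subtracting [x] only flips the sign of the cross term in [v s ^+ 2], so a square remains. *)
    have -> : r s - x = ((y / 2 - x * s / y) ^+ 2 / s + s) / 2.
      by rewrite /r /v; field; rewrite y0 gt_eqF.
    by rewrite divr_ge0 // addr_ge0 ?divr_ge0 ?sqr_ge0 // ltW.
pose d k := edist (p i) (p k).
have dE k : d k ^+ 2 = ((p k).1 - (p i).1) ^+ 2 + ((p k).2 - (p i).2) ^+ 2.
  by rewrite edist_sqr; ring.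
have d0 k : 0 <= d k by exact: sqrtr_ge0.
have yy : 0 < y ^+ 2 by rewrite exprn_even_gt0.
have dj : 0 < d j.
  rewrite lt_neqAle d0 andbT eq_sym; apply/eqP => dj0.
  by have := dE j; rewrite dj0 -/x -/y; have := sqr_ge0 x; nra.
pose s0 := y ^+ 2 / (2 * d j).
have s0gt : 0 < s0 by apply: divr_gt0 => //; exact: mulr_gt0.
have Lgt k : (k != i) && (k != j) -> 0 < L k s0.
  case/andP=> ki kj; apply: (@affine_gt0 _ _ _ (d j) _ _ (d k)) => //.
    by have := jmin k ki; rewrite -/(d j) -/(d k) /x; lra.
  apply: contra kj; rewrite xpair_eqE /x /y => /andP[/eqP h1 /eqP h2].
  apply/eqP/pinj; rewrite [LHS]surjective_pairing [RHS]surjective_pairing.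
  by congr pair; lra.
(* The function passed here is the slope of [L k] in [s]. *)
have [e e0 Le] := exists_small_step
  (fun k => 2 * (((p k).1 - (p i).1) - x * ((p k).2 - (p i).2) / y)) Lgt.
exists ((p i).1 + u s0, (p i).2 + v s0),
  ((p i).1 + u (s0 + e), (p i).2 + v (s0 + e)); split.
- rewrite xpair_eqE (inj_eq (addrI (p i).1)) (inj_eq (addrI (p i).2)).
  apply/negP => /andP[/eqP uE /eqP vE].
  (* The abscissa [(v^2 / s - s) / 2] is strictly decreasing in [s]. *)
  have : u (s0 + e) < u s0.
    rewrite /u -vE ltr_pM2r ?invr_gt0 //.
    have : v s0 ^+ 2 / (s0 + e) <= v s0 ^+ 2 / s0.
      apply: ler_wpM2l; first exact: sqr_ge0.
      by rewrite lef_pV2 ?posrE ?addr_gt0 // lerDl ltW.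
    lra.
  by rewrite uE ltxx.
- by apply: shared => // k ki kj; rewrite ltW // Lgt // ki.
- apply: shared => [|k ki kj]; first exact: addr_gt0.
  by have := Le k; rewrite ki kj => /(_ isT); rewrite /L; nra.
Qed.

Theorem theorem1 (R : realType) (B : R) (hB : 0 < B) (n : nat)
    (hn : (2 <= n)%N) (p : 'I_n -> R * R) (hp : injective p) :
  N_D p (first_index hn) `<=` N_V B p (first_index hn).
Proof.
move=> _ [[j /= ji <-] jmin]; exists j => //=.
have [k ki|q1 [q2 [q12 q1in q2in]]] := two_shared_points hB hp (j := j)
    (i := first_index hn).
  have pk : other_points p (first_index hn) (p k) by exists k.
  by have := jmin _ pk; lra.
split=> //; first by exists q1.
by case=> q qE; move: q1in q2in q12; rewrite qE /= => -> ->; rewrite eqxx.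
Qed.
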